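(* Let $H$ be a complex Hilbert space with $\dim H\ge 2$ and let $T\in B(H)$. If $\dim\ker T\le\dim\ker T^{*}$, then $$\mathrm{dist}(T,\mathbb{C}\mathcal{V})=\frac{\|T\|-m(T)}{2}=\frac{1-\sqrt{\frac{1-\hat{\varepsilon}(T)}{1+\hat{\varepsilon}(T)}}}{2}\,\|T\|.$$
   Context: $B(H)$ is the set of bounded linear operators on $H$, with operator norm $\|\cdot\|$. $\dim$ denotes Hilbert space dimension (a cardinal). $\mathcal{V}\subseteq B(H)$ is the set of all (linear) isometries on $H$, $\mathbb{C}\mathcal{V}=\{\lambda V:\lambda\in\mathbb{C},V\in\mathcal{V}\}$, and $\mathrm{dist}(T,\mathcal{S})=\inf_{S\in\mathcal{S}}\|T-S\|$. The minimum modulus is $m(T)=\inf\{\|Tx\|:\|x\|=1\}$. For $\varepsilon\in[0,1]$, $T\in B(H)$ is $\varepsilon$-AOP if $\langle x,y\rangle=0$ implies $|\langle Tx,Ty\rangle|\le\varepsilon\|Tx\|\,\|Ty\|$ for all $x,y\in H$; $\hat{\varepsilon}(T)=\inf\{\varepsilon\in[0,1]:T\text{ is }\varepsilon\text{-AOP}\}$. *)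

(* Defs.v *)
From HB Require Import structures.
From mathcomp Require Import all_boot all_order all_algebra.
From mathcomp Require Import complex.
From mathcomp Require Import all_classical all_reals all_analysis.

Set Implicit Arguments.
Unset Strict Implicit.
Unset Printing Implicit Defensive.

Import Order.TTheory GRing.Theory Num.Theory.
Import numFieldNormedType.Exports.

Local Open Scope classical_set_scope.
Local Open Scope card_scope.
Local Open Scope complex_scope.
Local Open Scope ring_scope.

(* The inner product is linear in its first argument and conjugate-linear in
   its second one. *)
HB.mixin Record isHilbert (R : realType) (H : Type)
    & CompleteNormedModule R[i] H := {
  inner : {dot H for (@Num.conj R[i])} ;
  sqr_normE : forall x : H, `|x| ^+ 2 = inner x x
}.

#[short(type="hilbertType")]
HB.structure Definition Hilbert (R : realType) :=
  {H of isHilbert R H & CompleteNormedModule R[i] H}.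

Notation "''[' x , y ]" := (inner x y) : ring_scope.

(* Over R[i] the norm of the library takes its values in R[i]; those values
   are real, and [rnorm] reads them in R. *)
Definition rnorm (R : realType) (V : normedZmodType R[i]) (x : V) : R :=
  complex.Re `|x|.

Section Operators.
Context {R : realType} {H : hilbertType R}.
Implicit Types (T : H -> H) (M B : set H).

Definition opnorm T : R := sup [set rnorm (T x) | x in [set x | rnorm x <= 1]].

Definition minmod T : R := inf [set rnorm (T x) | x in [set x | rnorm x = 1]].

Definition isometries : set (H -> H) :=
  [set V | linear V /\ forall x, rnorm (V x) = rnorm x].

Definition scaled_isometries : set (H -> H) :=
  [set S | exists (l : R[i]) (V : H -> H),
     isometries V /\ S = (fun x => l *: V x)].

Definition opdist T (A : set (H -> H)) : R :=
  inf [set opnorm (T \- S) | S in A].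

Definition AOP (e : R) T :=
  forall x y : H, '[x, y] = 0 ->
    rnorm ('[T x, T y] : R[i]) <= e * rnorm (T x) * rnorm (T y).

Definition eps_hat T : R := inf [set e | (0 <= e <= 1) /\ AOP e T].

(* For bounded linear T, the vector being picked exists and is unique by the
   Riesz representation theorem. *)
Definition adjoint T : H -> H :=
  fun y => xget 0 [set z | forall x, '[T x, y] = '[x, z]].

Definition ker T : set H := T @^-1` [set 0].

Definition lin_span B : set H :=
  [set x | exists (s : seq H) (a : H -> R[i]),
     (forall v, v \in s -> B v) /\ x = \sum_(v <- s) a v *: v].

Definition orthonormal_set B :=
  (forall x, B x -> '[x, x] = 1) /\
  (forall x y, B x -> B y -> x <> y -> '[x, y] = 0).

(* Meant for closed linear subspaces M. *)
Definition orthonormal_basis M B :=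
  [/\ B `<=` M, orthonormal_set B & M `<=` closure (lin_span B)].

(* Hilbert dimensions are compared as the cardinals of orthonormal bases; the
   choice of the bases is immaterial, since every closed subspace has one and
   any two of them are equipotent. *)
Definition hdim_le M N :=
  exists B C, [/\ orthonormal_basis M B, orthonormal_basis N C & B #<= C].

Definition hdim_ge (n : nat) M :=
  exists2 B, orthonormal_basis M B & `I_n #<= B.

End Operators.

(* Main.v *)
(* With [M = opnorm T] and [m = minmod T], the triangle inequality gives
   [M <= |T - l V| + |l|] and [|l| - |T - l V| <= m], hence the lower bound
   [(M - m) / 2] on the distance.  It is attained at [l = (M + m) / 2] and the
   isometry [V] of the polar decomposition [T = V P]: the hypothesis on the
   kernels makes [V] extend to the whole space, and [|T - l V| = |P - l|] with
   [m <= P <= M].  The constant [eps_hat T] is [(M^2 - m^2) / (M^2 + m^2)]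
   because [u + v] and [u - v] have equal norms when [u] and [v] are
   orthogonal, and are orthogonal when [u] and [v] have equal norms and
   [<u, v>] is real. *)

From HB Require Import structures.
Require Import Defs.
From mathcomp Require Import all_boot all_order all_algebra.
From mathcomp Require Import complex.
From mathcomp Require Import all_classical all_reals all_analysis.
From mathcomp Require Import ring lra.
Import Order.TTheory GRing.Theory Num.Theory.
Import numFieldNormedType.Exports.
Local Open Scope classical_set_scope.
Local Open Scope ring_scope.

Local Notation "r %:C" := (real_complex _ r) : ring_scope.

(** * Real-valued norms and inner products *)

Section RealNorm.
Context {R : realType} {V : normedZmodType R[i]}.
Implicit Types (x y z : V).

Lemma norm_rnorm x : `|x| = (rnorm x)%:C.
Proof. by rewrite /rnorm RRe_real // ger0_real. Qed.

Lemma rnorm_ge0 x : 0 <= rnorm x.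
Proof. by rewrite -lecR -norm_rnorm normr_ge0. Qed.

Lemma rnorm0 : rnorm (0 : V) = 0.
Proof. by rewrite /rnorm normr0. Qed.

Lemma rnorm_eq0 x : rnorm x = 0 -> x = 0.
Proof. by move=> x0; apply/eqP; rewrite -normr_eq0 norm_rnorm x0 eqxx. Qed.

Lemma rnorm_gt0 x : x <> 0 -> 0 < rnorm x.
Proof. by move=> x0; rewrite lt0r rnorm_ge0 andbT; apply/eqP => /rnorm_eq0. Qed.

Lemma rnormN x : rnorm (- x) = rnorm x.
Proof. by rewrite /rnorm normrN. Qed.

Lemma ler_rnormD x y : rnorm (x + y) <= rnorm x + rnorm y.
Proof. by rewrite -lecR rmorphD/= -!norm_rnorm ler_normD. Qed.

Lemma rnormBC x y : rnorm (x - y) = rnorm (y - x).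
Proof. by rewrite -rnormN opprB. Qed.

Lemma ler_rnormB x y z : rnorm (x - z) <= rnorm (x - y) + rnorm (y - z).
Proof. by rewrite -(subrKA y); apply: ler_rnormD. Qed.

Lemma ler_rnorm_subr x y : rnorm x <= rnorm y + rnorm (x - y).
Proof. by rewrite -{1}(subrKC y x) ler_rnormD. Qed.

End RealNorm.

Section RealNormScale.
Context {R : realType} {V : normedModType R[i]}.
Implicit Types (x : V) (r : R) (a : R[i]).

Lemma rnormZ a x : rnorm (a *: x) = rnorm a * rnorm x.
Proof.
by apply: complexI; rewrite rmorphM/= -!norm_rnorm normrZ.
Qed.

Lemma rnormZr r x : rnorm (r%:C *: x) = `|r| * rnorm x.
Proof.
by rewrite rnormZ; congr (_ * _); rewrite /rnorm normc_def/= expr0n addr0 sqrtr_sqr.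
Qed.

Lemma rnorm_unit x : x <> 0 -> rnorm ((rnorm x)^-1%:C *: x) = 1.
Proof.
move=> x0; have xp := rnorm_gt0 _ x0.
by rewrite rnormZr ger0_norm ?invr_ge0 ?ltW// mulVf// gt_eqF.
Qed.

End RealNormScale.

(** Rotating a vector by such a [c] makes an inner product real and nonnegative, so that bounds on
    real parts control moduli. *)
Lemma unit_phase {R : realType} (z : R[i]) :
  exists2 c : R[i], rnorm c = 1 & c * z = (rnorm z)%:C.
Proof.
have [->|z0] := eqVneq z 0.
  by exists 1; rewrite ?mul1r /rnorm ?normr1 ?normr0.
exists (`|z| / z); last by rewrite divfK// norm_rnorm.
by rewrite /rnorm normf_div normr_id divff ?normr_eq0.
Qed.

Lemma ReD {R : realType} (a b : R[i]) :
  complex.Re (a + b) = complex.Re a + complex.Re b.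
Proof. by case: a b => [? ?] []. Qed.

Lemma ReN {R : realType} (a : R[i]) : complex.Re (- a) = - complex.Re a.
Proof. by case: a. Qed.

Lemma ReZ {R : realType} (r : R) (a : R[i]) :
  complex.Re (r%:C * a) = r * complex.Re a.
Proof. by case: a => b c /=; rewrite mul0r subr0. Qed.

Section RealInner.
Context {R : realType} {H : hilbertType R}.
Implicit Types (x y z : H) (r : R).

(** The real part turns [H] into a real inner product space with the same norm, where estimates
    become polynomial inequalities between reals. *)
Definition rip x y : R := complex.Re '[x, y].

Lemma innerC x y : '[x, y] = conjc '[y, x].
Proof. by rewrite hermC/= expr0 mul1r. Qed.

Lemma innerZr (a : R[i]) x y : '[x, a *: y] = conjc a * '[x, y].
Proof. by rewrite linearZr_LR. Qed.

Lemma innerDr x y z : '[x, y + z] = '[x, y] + '[x, z].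
Proof. by rewrite linearDr. Qed.

Lemma ripC x y : rip x y = rip y x.
Proof. by rewrite /rip innerC; case: '[y, x]. Qed.

Lemma ripDl x y z : rip (x + y) z = rip x z + rip y z.
Proof. by rewrite /rip linearDl ReD. Qed.

Lemma ripDr x y z : rip x (y + z) = rip x y + rip x z.
Proof. by rewrite ripC ripDl !(ripC x). Qed.

Lemma ripZl r x y : rip (r%:C *: x) y = r * rip x y.
Proof. by rewrite /rip linearZl_LR ReZ. Qed.

Lemma ripZr r x y : rip x (r%:C *: y) = r * rip x y.
Proof. by rewrite ripC ripZl ripC. Qed.

Lemma ripNl x y : rip (- x) y = - rip x y.
Proof. by rewrite /rip linearNl ReN. Qed.

Lemma ripNr x y : rip x (- y) = - rip x y.
Proof. by rewrite ripC ripNl ripC. Qed.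

Lemma rip0l x : rip 0 x = 0.
Proof. by rewrite /rip linear0l. Qed.

Lemma rip0r x : rip x 0 = 0.
Proof. by rewrite ripC rip0l. Qed.

Definition ripE := (ripDl, ripDr, ripNl, ripNr, ripZl, ripZr, rip0l, rip0r).

Lemma rnormE x : rnorm x ^+ 2 = rip x x.
Proof. by rewrite /rip -sqr_normE norm_rnorm -rmorphXn. Qed.

Lemma rip_ge0 x : 0 <= rip x x.
Proof. by rewrite -rnormE sqr_ge0. Qed.

Lemma rnorm_le_sqr x r : 0 <= r -> rip x x <= r ^+ 2 -> rnorm x <= r.
Proof. by move=> r0; rewrite -rnormE ler_sqr ?nnegrE ?rnorm_ge0. Qed.

(** Cauchy-Schwarz, from the expansion of the squared norm of [|y| x - |x| y]. *)
Lemma rip_le x y : rip x y <= rnorm x * rnorm y.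
Proof.
have [->|/rnorm_gt0 x0] := pselect (x = 0); first by rewrite rip0l rnorm0 mul0r.
have [->|/rnorm_gt0 y0] := pselect (y = 0); first by rewrite rip0r rnorm0 mulr0.
have := rip_ge0 ((rnorm y)%:C *: x - (rnorm x)%:C *: y).
rewrite !ripE (ripC y x) -!rnormE => h.
rewrite -(ler_pM2l (mulr_gt0 x0 y0)); nra.
Qed.

Lemma ler_norm_rip x y : `|rip x y| <= rnorm x * rnorm y.
Proof.
by rewrite ler_norml rip_le lerNl -ripNl -(rnormN x) rip_le.
Qed.

(** The scalars 1 and i give the real part and minus the imaginary part. *)
Lemma inner_eq0 x y : (forall c : R[i], rip (c *: x) y = 0) -> '[x, y] = 0.
Proof.
move=> h; have := h 1; have := h (Complex 0 1).
rewrite scale1r /rip linearZl_LR/=; case: '[x, y] => a b /=.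
by rewrite mul0r mul1r sub0r => /eqP; rewrite oppr_eq0 => /eqP -> ->.
Qed.

Lemma rip_inner_inj x y : (forall z, rip z x = rip z y) -> x = y.
Proof.
move=> h; apply/eqP; rewrite -subr_eq0; apply/eqP/rnorm_eq0/eqP.
by rewrite -sqrf_eq0 rnormE ripDr ripNr h subrr.
Qed.

Lemma parallelogram x y :
  rnorm (x + y) ^+ 2 + rnorm (x - y) ^+ 2 = 2 * (rnorm x ^+ 2 + rnorm y ^+ 2).
Proof. by rewrite !rnormE !ripE (ripC y x); ring. Qed.

Lemma inner_norm_le x y : rnorm ('[x, y] : R[i]) <= rnorm x * rnorm y.
Proof.
have [c c1 hc] := unit_phase '[x, y].
have := rip_le (c *: x) y; rewrite rnormZ c1 mul1r /rip linearZl_LR/= hc.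
by [].
Qed.

End RealInner.

(** * Nearest points and the Riesz representation theorem *)

Section Hilbert.
Context {R : realType} {H : hilbertType R}.
Implicit Types (x y z : H) (r : R) (D : set H).

(** Completeness with an explicit rate: the limits below are then handled by inequalities whose
    error terms tend to 0. *)
Lemma cvg_rate (u : nat -> H) (r : nat -> R) :
  r @ \oo --> (0 : R) ->
  (forall n k, (n <= k)%N -> rnorm (u k - u n) <= r n) ->
  exists l, forall n, rnorm (u n - l) <= r n.
Proof.
move=> r0 ur.
have ucvg : cvg (u @ \oo).
  apply/cauchy_cvgP/cauchy_exP => e e0.
  have ee : e = (complex.Re e)%:C by rewrite RRe_real// gtr0_real.
  have e0' : 0 < complex.Re e by rewrite -ltcR -ee.
  have /cvgrPdist_lt/(_ _ e0')[N _ hN] := r0.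
  exists (u N); exists N => // k /= Nk.
  rewrite -ball_normE/= ee norm_rnorm ltcR rnormBC (le_lt_trans (ur _ _ Nk))//.
  by have := hN N (leqnn N); rewrite /= sub0r normrN; apply: le_lt_trans (ler_norm _).
exists (lim (u @ \oo)) => n; apply/ler_addgt0Pr => e e0.
have e0' : 0 < e%:C by rewrite ltcR.
have /cvgrPdist_lt/(_ _ e0')[N _ hN] := ucvg.
pose k := maxn n N.
have := hN k (leq_maxr _ _); rewrite /= norm_rnorm ltcR => hk.
rewrite (le_trans (ler_rnormB _ (u k) _))// lerD//.
  by rewrite rnormBC ur ?leq_maxl.
by rewrite rnormBC ltW.
Qed.

Lemma rate_lt (r : nat -> R) e :
  r @ \oo --> (0 : R) -> 0 < e -> exists n, r n < e.
Proof.
move=> /cvgrPdist_lt r0 /r0[N _ hN]; exists N.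
by have := hN N (leqnn N); rewrite /= sub0r normrN; apply: le_lt_trans (ler_norm _).
Qed.

Lemma cvgM0 (r : nat -> R) (c : R) :
  r @ \oo --> (0 : R) -> (fun n => c * r n) @ \oo --> (0 : R).
Proof. by move=> r0; rewrite -[0](mulr0 c); apply: cvgM => //; apply: cvg_cst. Qed.

Lemma ler_rate (r : nat -> R) (a b c : R) :
  r @ \oo --> (0 : R) -> (forall n, a <= b + c * r n) -> a <= b.
Proof.
move=> r0 h; have hc : (fun n => b + c * r n) @ \oo --> b.
  by rewrite -[X in _ --> X]addr0; apply: cvgD (cvgM0 _ _ r0); apply: cvg_cst.
by apply: (cvgr_to_ge hc); near=> n; exact: h.
Unshelve. all: by end_near. Qed.

Lemma harmonic_le n k : (n <= k)%N -> harmonic k <= harmonic n :> R.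
Proof. by move=> nk; rewrite /= lef_pV2 ?posrE ?ltr0n// ler_nat. Qed.

Section Submodule.
Variable D : set H.
Hypotheses (D0 : D 0) (Dlin : forall (a : R[i]) x y, D x -> D y -> D (a *: x + y)).

Let DZ a x : D x -> D (a *: x).
Proof. by move=> Dx; rewrite -[_ *: _]addr0; apply: Dlin. Qed.

(* The point of the closed affine set [x0 + closure D] nearest to 0. *)
Lemma coset_orthogonal x0 : exists z,
  (forall e, 0 < e -> exists2 d, D d & rnorm (x0 + d - z) < e) /\
  (forall d, D d -> '[d, z] = 0).
Proof.
have half x : 2^-1%:C *: (x + x) = x.
  by rewrite scalerDr -scalerDl -rmorphD/= (_ : _ + _ = 1) ?scale1r//; field.
pose S := [set rnorm (x0 + d) ^+ 2 | d in D].
have S0 : S !=set0 by exists (rnorm (x0 + 0) ^+ 2), 0.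
have Slb : has_inf S by split => //; exists 0 => _ [d _ <-]; rewrite sqr_ge0.
have infS d : D d -> inf S <= rnorm (x0 + d) ^+ 2.
  by move=> Dd; apply: ge_inf; [case: Slb | exists d].
(* A minimizing sequence. With the tolerance [harmonic n ^+ 2], the parallelogram identity and the
   midpoint of two terms bound later gaps by [2 * harmonic n]. *)
have /choice[d hd] n : exists d, D d /\ rnorm (x0 + d) ^+ 2 < inf S + harmonic n ^+ 2.
  have [|_ [d Dd <-] h] := @inf_adherent _ S (harmonic n ^+ 2) _ Slb.
    by rewrite exprn_gt0// harmonic_gt0.
  by exists d.
have h0 n : 0 < harmonic n :> R by exact: harmonic_gt0.
have h1 n : harmonic n <= 1 :> R by rewrite /= invf_le1 ?ltr0n// ler1n.
have [|n k nk|z hz] := @cvg_rate (fun n => x0 + d n) (fun n => 2 * harmonic n).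
- by apply: cvgM0; exact: cvg_harmonic.
- have [[Dn dn] [Dk dk]] := (hd n, hd k).
  rewrite -(ler_sqr _ _) ?nnegrE ?rnorm_ge0 ?mulr_ge0 ?ltW//.
  have Dm : D (2^-1%:C *: (d n + d k)).
    by apply: DZ; rewrite -[d n]scale1r; apply: Dlin.
  have := infS _ Dm.
  have -> : x0 + 2^-1%:C *: (d n + d k) = 2^-1%:C *: ((x0 + d k) + (x0 + d n)).
    by rewrite -{1}(half x0) -scalerDr addrACA addrC.
  rewrite rnormZr exprMn ger0_norm ?invr_ge0// => hm.
  have := parallelogram (x0 + d k) (x0 + d n).
  have := harmonic_le _ _ nk; have := h0 k; have := h0 n.
  nra.
exists z; split => [e e0|x Dx].
  have [|N hN] := rate_lt (fun n => 2 * harmonic n) e _ e0.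
    by apply: cvgM0; exact: cvg_harmonic.
  exists (d N); first by case: (hd N).
  exact: le_lt_trans (hz N) hN.
apply: inner_eq0 => c; have := DZ c _ Dx; move: (c *: x) => {c Dx}x Dx.
rewrite ripC.
(* Minimality of [z] along the line [z + t x], read off on the minimizing sequence: the error is at
   most [harmonic n ^+ 2] plus [2 |t| |x|] times the rate [2 * harmonic n]. *)
have key t : 0 <= 2 * t * rip z x + t ^+ 2 * rip x x.
  apply: (@ler_rate harmonic _ _ (1 + 4 * `|t| * rnorm x)) => [|n].
    exact: cvg_harmonic.
  have [Dn dn] := hd n.
  have := infS _ (Dlin t%:C _ _ Dx Dn).
  rewrite addrCA; move: (x0 + d n) (hz n) dn => u uz.
  rewrite !rnormE !ripE (ripC x) => un.
  have := ler_norm_rip (u - z) (t%:C *: x).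
  have := ler_wpM2l (mulr_ge0 (normr_ge0 t) (rnorm_ge0 x)) uz.
  have := h0 n; have := h1 n.
  rewrite rnormZr !ripE ler_norml => hn1 hn0 h2 /andP[_ h3] h4.
  have : harmonic n ^+ 2 <= harmonic n :> R by rewrite expr2 ler_piMr// ltW.
  nra.
have b0 : 0 <= rip x x by exact: rip_ge0.
(* The denominator [rip x x + 1], instead of [rip x x], also covers [x = 0]; the form then equals a
   nonpositive multiple of the square of [rip z x]. *)
have := key (- rip z x / (rip x x + 1)).
move: (rip z x) (rip x x) b0 => a b b0.
have -> : 2 * (- a / (b + 1)) * a + (- a / (b + 1)) ^+ 2 * b =
          - (a / (b + 1)) ^+ 2 * (b + 2) by field; lra.
rewrite mulNr oppr_ge0 pmulr_lle0; last by lra.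
rewrite le_eqVlt ltNge sqr_ge0 orbF sqrf_eq0 mulf_eq0 invr_eq0 orbC.
by rewrite gt_eqF//=; [move/eqP|lra].
Qed.

(** The nearest point of the closed coset of [x] is orthogonal to [D], hence 0; elements [d] with
    [x + d] small are then negated. *)
Lemma orthogonal_dense : (forall z, (forall d, D d -> '[d, z] = 0) -> z = 0) ->
  forall x e, 0 < e -> exists2 d, D d & rnorm (x - d) < e.
Proof.
move=> D_total x e e0; have [z [hz /D_total z0]] := coset_orthogonal x.
have [d Dd] := hz e e0; rewrite z0 subr0 => xd.
by exists (-1 *: d); [apply: DZ|rewrite scaleN1r opprK].
Qed.

End Submodule.

(** The representing vector is a multiple of the point nearest to 0 on a hyperplane [x0 + ker phi]
    that avoids 0. *)
Lemma riesz (phi : H -> R[i]) (K : R) :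
  (forall a x y, phi (a *: x + y) = a * phi x + phi y) ->
  (forall x, rnorm (phi x) <= K * rnorm x) ->
  exists z, forall x, phi x = '[x, z].
Proof.
move=> phi_lin phi_bnd.
have phi0 : phi 0 = 0.
  by have := phi_lin (-1) 0 0; rewrite scaler0 addr0 mulN1r addNr.
have [phi_triv|/existsNP[x0 /eqP px0]] := pselect (forall x, phi x = 0).
  by exists 0 => x; rewrite phi_triv linear0r.
have [||z [zlim zort]] := @coset_orthogonal [set x | phi x = 0] _ _ x0.
- exact: phi0.
- by move=> a x y /= px py; rewrite phi_lin px py mulr0 addr0.
(* [z] is only known as a limit of points of the coset, where [phi] is constant; the bound on [phi]
   passes this value to [z]. *)
have pz : phi z = phi x0.
  apply/eqP; rewrite -subr_eq0; apply/eqP/rnorm_eq0/le_anti; rewrite rnorm_ge0 andbT.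
  apply: (@ler_rate harmonic _ _ `|K|) => [|n]; first exact: cvg_harmonic.
  have [d /= pd hd] := zlim (harmonic n) (harmonic_gt0 _).
  have -> : phi z - phi x0 = phi (-1 *: (x0 + d - z)).
    rewrite -[_ *: _]addr0 phi_lin phi0 addr0.
    have -> : x0 + d - z = -1 *: z + (1 *: x0 + d) by rewrite scaleN1r scale1r addrC.
    by rewrite !phi_lin pd; ring.
  rewrite add0r (le_trans (phi_bnd _))// scaleN1r rnormN.
  by rewrite (le_trans (ler_wpM2r (rnorm_ge0 _) (ler_norm K)))// ler_wpM2l// ltW.
have z0 : '[z, z] != 0.
  apply/eqP => zz; have : rnorm z = 0.
    by apply/eqP; rewrite -sqrf_eq0 rnormE /rip zz.
  by move/rnorm_eq0 => z0; move: px0; rewrite -pz z0 phi0 eqxx.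
exists (conjc (phi z / '[z, z]) *: z) => x.
rewrite innerZr conjcK.
have : phi (- (phi x / phi z) *: z + x) = 0.
  by rewrite phi_lin mulNr divfK ?pz// addNr.
move=> /(zort _); rewrite linearDl linearZl_LR/= => /eqP.
rewrite mulNr addrC subr_eq0 => /eqP ->.
by field; rewrite pz px0; exact: z0.
Qed.

(** By Riesz the set in the definition of [adjoint] is nonempty, so [xget] does not return its
    default 0. *)
Lemma inner_adjoint (T : {linear H -> H}) (K : R) :
  (forall x, rnorm (T x) <= K * rnorm x) ->
  forall x y, '[T x, y] = '[x, adjoint T y].
Proof.
move=> Tbnd x y.
have [||w hw] := @riesz (fun x => '[T x, y]) (K * rnorm y).
- by move=> a u v; rewrite linearP linearDl linearZl_LR.
- by move=> u; rewrite (le_trans (inner_norm_le _ _))// mulrAC ler_wpM2r ?rnorm_ge0.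
by have := @xgetPex _ 0 [set z | forall u, '[T u, y] = '[u, z]] (ex_intro _ w hw); apply.
Qed.

End Hilbert.

(** * Extension of isometries *)

Section IsometryExtension.
Context {R : realType} {H : hilbertType R} (I : Type) (u v : I -> H).
Hypothesis gram : forall i j, '[u i, u j] = '[v i, v j].
Hypothesis u_total : forall z, (forall i, '[u i, z] = 0) -> z = 0.

(** A list is a formal combination, to be evaluated on both families; indices may repeat, so
    addition is concatenation. *)
Let lc (w : I -> H) (s : seq (R[i] * I)) : H := \sum_(p <- s) p.1 *: w p.2.

Let lc_lin w a s t :
  lc w ([seq (a * p.1, p.2) | p <- s] ++ t) = a *: lc w s + lc w t.
Proof.
rewrite /lc big_cat big_map scaler_sumr; congr (_ + _).
by apply: eq_bigr => p _; rewrite scalerA.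
Qed.

Let lc_gram s t : '[lc u s, lc u t] = '[lc v s, lc v t].
Proof.
have suml w r y : '[lc w r, y] = \sum_(p <- r) p.1 * '[w p.2, y].
  rewrite /lc (big_morph (fun x => '[x, y]) (id1 := 0) (op1 := +%R)).
  - by apply: eq_bigr => p _; rewrite linearZl_LR.
  - by move=> a b; rewrite linearDl.
  - by rewrite linear0l.
rewrite !suml; apply: eq_bigr => p _; congr (_ * _).
rewrite innerC suml [RHS]innerC suml; congr conjc.
by apply: eq_bigr => q _; rewrite gram.
Qed.

Let lc_norm s : rnorm (lc u s) = rnorm (lc v s).
Proof.
by apply: complexI; rewrite -!norm_rnorm; apply: (@pexpIrn _ 2);
  rewrite ?nnegrE ?normr_ge0// !sqr_normE lc_gram.
Qed.

(** The closure of the pairs [(lc u s, lc v s)]: it is shown to be linear, norm preserving, single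
    valued and total, hence the graph of an isometry. *)
Let graph x y := forall e, 0 < e ->
  exists s, rnorm (x - lc u s) < e /\ rnorm (y - lc v s) < e.

Let graph_lin a x y x' y' :
  graph x y -> graph x' y' -> graph (a *: x + x') (a *: y + y').
Proof.
move=> xy xy' e e0; have a0 := rnorm_ge0 a.
have e1 : 0 < e / (rnorm a + 1) by rewrite divr_gt0//; lra.
have [[s [xs ys]] [t [xt yt]]] := (xy _ e1, xy' _ e1).
have bound z z' w w' : rnorm (z - w) < e / (rnorm a + 1) ->
    rnorm (z' - w') < e / (rnorm a + 1) ->
    rnorm (a *: z + z' - (a *: w + w')) < e.
  move=> zw zw'; rewrite opprD addrACA -scalerBr (le_lt_trans (ler_rnormD _ _))//.
  rewrite rnormZ.
  have -> : e = rnorm a * (e / (rnorm a + 1)) + e / (rnorm a + 1) by field; lra.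
  by rewrite ler_ltD// ler_wpM2l// ltW.
exists ([seq (a * p.1, p.2) | p <- s] ++ t).
by rewrite !lc_lin; split; apply: bound.
Qed.

Let graph_norm x y : graph x y -> rnorm x = rnorm y.
Proof.
move=> xy; apply: le_anti; apply/andP; split; apply/ler_addgt0Pr => e e0;
  have [|s [xs ys]] := xy (e / 2) _; rewrite ?divr_gt0//.
- have := ler_rnorm_subr x (lc u s); have := ler_rnorm_subr (lc v s) y.
  rewrite (rnormBC _ y) lc_norm; lra.
- have := ler_rnorm_subr y (lc v s); have := ler_rnorm_subr (lc u s) x.
  rewrite (rnormBC _ x) lc_norm; lra.
Qed.

Let graph_inj x y y' : graph x y -> graph x y' -> y = y'.
Proof.
move=> xy xy'; have /graph_norm := graph_lin (-1) _ _ _ _ xy xy'.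
rewrite !scaleN1r addNr rnorm0 => /esym/rnorm_eq0/eqP.
by rewrite addrC subr_eq0 => /eqP.
Qed.

(** By [u_total] the combinations of [u] are dense. Those approaching [x] are Cauchy, and by
    [lc_norm] so are the same combinations of [v], whose limit is [y]. *)
Let graph_total x : exists y, graph x y.
Proof.
have dense n : exists s, rnorm (x - lc u s) < harmonic n.
  have [||z hz|d [s _ <-]] :=
    @orthogonal_dense _ _ (range (lc u)) _ _ _ x _ (harmonic_gt0 n).
  - by exists [::] => //; rewrite /lc big_nil.
  - move=> a _ _ [s _ <-] [t _ <-]; rewrite -lc_lin.
    by exists ([seq (a * p.1, p.2) | p <- s] ++ t).
  - apply: u_total => i; apply: hz; exists [:: (1, i)] => //.
    by rewrite /lc big_seq1 scale1r.
  - by exists s.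
have /choice[s hs] := dense.
have r0 : (fun n => 2 * harmonic n) @ \oo --> (0 : R).
  by apply: cvgM0; exact: cvg_harmonic.
have [|y hy] := cvg_rate (fun n => lc v (s n)) _ r0.
  move=> n k nk.
  have := lc_lin v (-1) (s n) (s k); rewrite scaleN1r addrC => <-.
  rewrite -lc_norm lc_lin scaleN1r addrC.
  have := ler_rnormB (lc u (s k)) x (lc u (s n)).
  have := harmonic_le _ _ nk : _ <= _ :> R; have := hs k; have := hs n.
  rewrite (rnormBC x (lc u (s k))); lra.
exists y => e e0; have [n hn] := rate_lt _ _ r0 e0.
exists (s n); rewrite (rnormBC y); split; last exact: le_lt_trans (hy n) hn.
by have := hs n; have := harmonic_gt0 n : 0 < _ :> R; lra.
Qed.

Lemma isometry_extension : exists2 V : H -> H, isometries V & forall i, V (u i) = v i.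
Proof.
have /choice[V hV] := graph_total.
exists V.
  split=> [a x y|x]; last by rewrite (graph_norm _ _ (hV x)).
  by apply: (graph_inj _ _ _ (hV _)); apply: graph_lin; apply: hV.
move=> i; apply: (graph_inj _ _ _ (hV _)) => e e0.
by exists [:: (1, i)]; rewrite /lc !big_seq1 !scale1r !subrr !rnorm0.
Qed.

End IsometryExtension.

(** * Square roots of positive operators *)

Lemma linear_bundle {R : realType} {H : hilbertType R} (S : H -> H) :
  linear S -> exists f : {linear H -> H}, S = f.
Proof.
move=> Slin; pose m := GRing.isLinear.Build _ _ _ _ S Slin.
by exists (HB.pack_for {linear H -> H} S m).
Qed.

Section PositiveOperators.
Context {R : realType} {H : hilbertType R}.
Implicit Types (x y : H).

(** For complex-linear [S] this is self-adjointness: scaling [x] by i recovers the imaginary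
    parts. *)
Definition symmetric_op (S : H -> H) := forall x y, rip (S x) y = rip x (S y).

(* Positivity of the form [rip (S _) _] at [c x - S x]. *)
Lemma positive_sqr_le (S : {linear H -> H}) (c : R) : 0 <= c -> symmetric_op S ->
  (forall x, 0 <= rip (S x) x <= c * rip x x) ->
  forall x, rip (S x) (S x) <= c * rip (S x) x.
Proof.
move=> c0 Ssym Spos x.
have pos t : 0 <= t ^+ 2 * rip (S x) x - 2 * t * rip (S x) (S x) + c * rip (S x) (S x).
  have /andP[+ _] := Spos (t%:C *: x - S x).
  have /andP[_ +] := Spos (S x).
  by rewrite linearB linearZ/= !ripE (Ssym (S x) x); nra.
(* [t = c] gives the claim multiplied by [c]. If [c = 0] the form vanishes, and [t = 1] forces
   [S x = 0]. *)
have [c0'|c0'] := ltP 0 c.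
  by rewrite -(ler_pM2l c0'); have := pos c; lra.
have {}c0 : c = 0 by apply: le_anti; rewrite c0 c0'.
by have := pos 1; have := Spos x; rewrite c0 !mul0r => /le_anti <-; lra.
Qed.

Section SquareRoot.
Variables (B : {linear H -> H}) (c b : R).
Hypotheses (c01 : 0 <= c <= 1) (bE : b = 2 * c - c ^+ 2).
Hypotheses (Bsym : symmetric_op B) (Bpos : forall x, 0 <= rip (B x) x <= b * rip x x).

Let b0 : 0 <= b. Proof. by rewrite bE; case/andP: c01 => *; nra. Qed.

Let B_norm x : rnorm (B x) <= b * rnorm x.
Proof.
apply: rnorm_le_sqr; first by rewrite mulr_ge0 ?rnorm_ge0.
rewrite exprMn rnormE.
have := positive_sqr_le _ _ b0 Bsym Bpos x; have /andP[_ h] := Bpos x.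
by have := ler_wpM2l b0 h; lra.
Qed.

(* [Q_ n.+1 - Q_ n] has norm at most [q n.+1 - q n], and [q] increases and is
   bounded by the fixed point [c] of [t |-> (b + t ^+ 2) / 2]. *)
Let q := fix q n : R := if n is n'.+1 then (b + q n' ^+ 2) / 2 else 0.
Let Q_ := fix Q n : H -> H :=
  if n is n'.+1 then fun x => 2^-1%:C *: (B x + Q n' (Q n' x)) else fun=> 0.

Let qS n : q n.+1 = (b + q n ^+ 2) / 2. Proof. by []. Qed.
Let QS n x : Q_ n.+1 x = 2^-1%:C *: (B x + Q_ n (Q_ n x)). Proof. by []. Qed.

Let q_ge0 n : 0 <= q n.
Proof. by case: n => // n; rewrite qS; have := sqr_ge0 (q n); have := b0; lra. Qed.

Let q_le n : q n <= c.
Proof.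
elim: n => [|n IH]; first by case/andP: c01.
have : q n ^+ 2 <= c ^+ 2 by rewrite ler_sqr ?nnegrE ?q_ge0//; case/andP: c01.
by rewrite qS bE; lra.
Qed.

Let q_homo : {homo q : n k / (n <= k)%N >-> n <= k}.
Proof.
apply: homo_leq => [//|y x z|n]; first exact: le_trans.
elim: n => [|n IH]; first exact: q_ge0.
have : q n ^+ 2 <= q n.+1 ^+ 2 by rewrite ler_sqr ?nnegrE ?q_ge0.
by have := qS n; have := qS n.+1; lra.
Qed.

Let r n := lim (q @ \oo) - q n.

Let q_cvg : cvgn q.
Proof.
apply: nondecreasing_is_cvgn => [//|]; exists c => _ [n _ <-]; exact: q_le.
Qed.

Let r_cvg : r @ \oo --> (0 : R).
Proof. by rewrite -(subrr (lim (q @ \oo))); apply: cvgB => //; apply: cvg_cst. Qed.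

Let q_lim n k : (n <= k)%N -> q k - q n <= r n.
Proof. by move=> nk; rewrite lerB// nondecreasing_cvgn_le. Qed.

Let r_ge0 n : 0 <= r n.
Proof. by have := q_lim n n (leqnn n); rewrite subrr. Qed.

Let Q_lin n : linear (Q_ n).
Proof.
elim: n => [|n IH] a x y; first by rewrite /= scaler0 addr0.
rewrite !QS !IH linearP addrACA -(scalerDr a) (scalerDr (2^-1)%:C) !scalerA.
by rewrite mulrC.
Qed.

Let Q_B n x y : Q_ n (x - y) = Q_ n x - Q_ n y.
Proof. by have := Q_lin n (-1) y x; rewrite !scaleN1r !(addrC (- _)). Qed.

Let Q_sym n : symmetric_op (Q_ n).
Proof.
elim: n => [|n IH] x y; first by rewrite /= !ripE.
by rewrite !QS !ripE Bsym !IH.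
Qed.

Let Q_norm n x : rnorm (Q_ n x) <= q n * rnorm x.
Proof.
elim: n x => [|n IH] x; first by rewrite /= rnorm0 mul0r.
rewrite QS qS rnormZr ger0_norm ?invr_ge0//.
have := ler_rnormD (B x) (Q_ n (Q_ n x)); have := B_norm x.
have := IH (Q_ n x); have := ler_wpM2l (q_ge0 n) (IH x); lra.
Qed.

(** With [D = Q_ n.+1 - Q_ n], the difference of the squares is [Q_ n.+1 D + D Q_ n]; taking norms
    reproduces the recursion for the increments of [q]. *)
Let Q_step n x : rnorm (Q_ n.+1 x - Q_ n x) <= (q n.+1 - q n) * rnorm x.
Proof.
elim: n x => [|n IH] x.
  by rewrite /= !subr0 (le_trans (Q_norm 1 x)).
have -> : Q_ n.+2 x - Q_ n.+1 x = 2^-1%:C *: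
    (Q_ n.+1 (Q_ n.+1 x - Q_ n x) + (Q_ n.+1 (Q_ n x) - Q_ n (Q_ n x))).
  rewrite Q_B subrKA [Q_ n.+1 x in X in _ - X]QS [Q_ n.+2 x]QS -scalerBr.
  by rewrite opprD addrACA subrr add0r.
rewrite rnormZr ger0_norm ?invr_ge0//.
have := ler_rnormD (Q_ n.+1 (Q_ n.+1 x - Q_ n x)) (Q_ n.+1 (Q_ n x) - Q_ n (Q_ n x)).
have := le_trans (Q_norm _ _) (ler_wpM2l (q_ge0 n.+1) (IH x)).
have qq : 0 <= q n.+1 - q n by rewrite subr_ge0 q_homo.
have := le_trans (IH _) (ler_wpM2l qq (Q_norm n x)).
have -> : q n.+2 - q n.+1 = (q n.+1 + q n) * (q n.+1 - q n) / 2.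
  by have := qS n; have := qS n.+1; lra.
lra.
Qed.

Let Q_cauchy x n k : (n <= k)%N -> rnorm (Q_ k x - Q_ n x) <= r n * rnorm x.
Proof.
move=> nk; apply: le_trans (ler_wpM2r (rnorm_ge0 x) (q_lim _ _ nk)).
elim: k nk => [|k IH]; first by rewrite leqn0 => /eqP ->; rewrite !subrr mul0r rnorm0.
rewrite leq_eqVlt => /orP[/eqP ->|]; first by rewrite !subrr mul0r rnorm0.
rewrite ltnS => /IH nk.
by have := ler_rnormB (Q_ k.+1 x) (Q_ k x) (Q_ n x); have := Q_step k x; lra.
Qed.

(** The fixed-point equation says that [1 - Q] squares to [1 - B], just as [1 - c] squares to
    [1 - b]. [Q] is the pointwise limit of [Q_]. *)
Lemma sqrt_fixpoint : exists Q : {linear H -> H},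
  [/\ symmetric_op Q, forall x, Q x = 2^-1%:C *: (B x + Q (Q x)),
      forall x, rnorm (Q x) <= c * rnorm x & forall x, 0 <= rip (Q x) x].
Proof.
have rx (x : H) : (fun n => r n * rnorm x) @ \oo --> (0 : R).
  rewrite -[X in _ --> X](mul0r (rnorm x)); apply: cvgM => //; exact: cvg_cst.
have /choice[Q hQ] x := cvg_rate (fun n => Q_ n x) _ (rx x) (Q_cauchy x).
have Qlin : linear Q.
  move=> a x y; apply/eqP; rewrite -subr_eq0; apply/eqP/rnorm_eq0/le_anti.
  rewrite rnorm_ge0 andbT.
  apply: (@ler_rate _ r _ _ (rnorm (a *: x + y) + rnorm a * rnorm x + rnorm y)) => // n.
  have -> : Q (a *: x + y) - (a *: Q x + Q y) =
    (Q (a *: x + y) - Q_ n (a *: x + y)) + (a *: (Q_ n x - Q x) + (Q_ n y - Q y)).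
    by rewrite Q_lin scalerBr [X in _ = _ + X]addrACA -opprD subrKA.
  have := ler_rnormD (Q (a *: x + y) - Q_ n (a *: x + y))
                     (a *: (Q_ n x - Q x) + (Q_ n y - Q y)).
  have := ler_rnormD (a *: (Q_ n x - Q x)) (Q_ n y - Q y).
  have := hQ (a *: x + y) n; have := hQ y n; have := ler_wpM2l (rnorm_ge0 a) (hQ x n).
  by rewrite rnormZ (rnormBC (Q (a *: x + y))); lra.
have Qnorm x : rnorm (Q x) <= c * rnorm x.
  apply: (@ler_rate _ r _ _ (rnorm x)) => // n.
  have := ler_rnorm_subr (Q x) (Q_ n x); have := hQ x n; have := Q_norm n x.
  have := ler_wpM2r (rnorm_ge0 x) (q_le n).
  by rewrite rnormBC; lra.
have Qsym : symmetric_op Q.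
  (* Limits only yield inequalities here; exchanging [x] and [y] gives the converse one. *)
  suff le x y : rip (Q x) y <= rip x (Q y).
    by move=> x y; apply: le_anti; rewrite le/= ripC (ripC (Q x)).
  apply: (@ler_rate _ r _ _ (2 * rnorm x * rnorm y)) => // n.
  have := rip_le (Q x - Q_ n x) y; have := rip_le x (Q_ n y - Q y).
  have := ler_wpM2r (rnorm_ge0 y) (hQ x n); have := ler_wpM2l (rnorm_ge0 x) (hQ y n).
  by rewrite !ripE (rnormBC (Q x)) Q_sym; lra.
have Qfix x : Q x = 2^-1%:C *: (B x + Q (Q x)).
  apply/eqP; rewrite -subr_eq0; apply/eqP/rnorm_eq0/le_anti.
  rewrite rnorm_ge0 andbT.
  apply: (@ler_rate _ r _ _ (rnorm x * 2 + rnorm (Q x))) => // n.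
  have -> : Q x - 2^-1%:C *: (B x + Q (Q x)) = (Q x - Q_ n.+1 x) +
     2^-1%:C *: (Q_ n (Q_ n x - Q x) + (Q_ n (Q x) - Q (Q x))).
    have -> : Q_ n (Q_ n x - Q x) + (Q_ n (Q x) - Q (Q x)) =
        (B x + Q_ n (Q_ n x)) - (B x + Q (Q x)).
      by rewrite Q_B subrKA opprD addrACA subrr add0r.
    by rewrite QS scalerBr subrKA.
  have := ler_rnormD (Q x - Q_ n.+1 x)
     (2^-1%:C *: (Q_ n (Q_ n x - Q x) + (Q_ n (Q x) - Q (Q x)))).
  have := ler_rnormD (Q_ n (Q_ n x - Q x)) (Q_ n (Q x) - Q (Q x)).
  have := hQ x n.+1; have := hQ (Q x) n.
  have rr : r n.+1 <= r n by rewrite lerB// q_homo.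
  have := ler_wpM2r (rnorm_ge0 x) rr.
  have := le_trans (Q_norm n _) (ler_wpM2l (q_ge0 n) (hQ x n)).
  have q1 : q n <= 1 by rewrite (le_trans (q_le n))//; case/andP: c01.
  have := ler_wpM2r (mulr_ge0 (r_ge0 n) (rnorm_ge0 x)) q1.
  have := mulr_ge0 (r_ge0 n) (rnorm_ge0 (Q x)).
  have := mulr_ge0 (r_ge0 n) (rnorm_ge0 x).
  by rewrite rnormZr ger0_norm ?invr_ge0// (rnormBC (Q x)); lra.
(* By the fixed-point equation this is half of [rip (B x) x] plus the squared norm of [Q x]. *)
have Qpos x : 0 <= rip (Q x) x.
  rewrite Qfix !ripE Qsym mulr_ge0 ?invr_ge0// addr_ge0 ?rip_ge0//.
  by case/andP: (Bpos x).
have [f Qf] := linear_bundle _ Qlin.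
by exists f; rewrite Qf in Qsym Qfix Qnorm Qpos.
Qed.

End SquareRoot.

End PositiveOperators.

(** * The modulus of a bounded operator *)

Section Modulus.
Context {R : realType} {H : hilbertType R}.
Implicit Types (x y : H).

Lemma inner_ext (x y x' y' : H) :
  (forall c : R[i], rip (c *: x) y = rip (c *: x') y') -> '[x, y] = '[x', y'].
Proof.
move=> h; have := h 1; have := h (Complex 0 1).
rewrite !scale1r /rip !linearZl_LR/=; case: '[x, y] '[x', y'] => [a b] [a' b'] /=.
by rewrite !mul0r !mul1r !sub0r => /oppr_inj -> ->.
Qed.

(* [B = 1 - T^* T / M^2] is a positive operator of norm at most
   [1 - (m / M)^2], so [P = M (1 - Q)] with [Q = (B + Q^2) / 2] squares to
   [T^* T]. *)
Lemma modulus (T : {linear H -> H}) (M m : R) :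
  0 <= m <= M -> (forall x, rnorm (T x) <= M * rnorm x) ->
  (forall x, m * rnorm x <= rnorm (T x)) ->
  exists P : {linear H -> H}, [/\ symmetric_op P,
    forall x y, '[P x, P y] = '[T x, T y] &
    forall x, rnorm (P x - ((M + m) / 2)%:C *: x) <= (M - m) / 2 * rnorm x].
Proof.
move=> /andP[m0 mM] TM Tm.
(* The construction divides by [M]; for [M = 0] the operator is 0 and so is [P]. *)
have [M0|M0] := leP M 0.
  have M_eq0 : M = 0 by lra.
  have m_eq0 : m = 0 by lra.
  have T0 x : T x = 0.
    by apply/rnorm_eq0/le_anti; rewrite rnorm_ge0 andbT -(mul0r (rnorm x)) -M_eq0.
  exists \0; split.
  - by move=> x y; rewrite !ripE.
  - by move=> x y; rewrite !T0.
  - by move=> x; rewrite M_eq0 m_eq0 addr0 subr0 !mul0r scale0r subr0 rnorm0.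
have adj := inner_adjoint T M TM.
have adjr x y : rip (T x) y = rip x (adjoint T y) by rewrite /rip adj.
pose A x := adjoint T (T x).
have Asym x y : rip (A x) y = rip (T x) (T y) by rewrite ripC -adjr ripC.
have adjlin a u v : adjoint T (a *: u + v) = a *: adjoint T u + adjoint T v.
  by apply: rip_inner_inj => z; congr complex.Re; rewrite -adj !innerDr !innerZr -!adj.
pose B0 x := x - (M ^- 2)%:C *: A x.
have B0lin : linear B0.
  move=> a x y; rewrite /B0 /A linearP adjlin scalerDr opprD addrACA; congr (_ + _).
  by rewrite scalerBr !scalerA mulrC.
have [B BE] := linear_bundle _ B0lin.
have BR x y : rip (B x) y = rip x y - M ^- 2 * rip (T x) (T y).
  by rewrite -BE /B0 !ripE Asym.
have Mi : 0 < M ^- 2 by rewrite invr_gt0 exprn_gt0.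
have [||x y|x|Q [Qsym Qfix Qnorm Qpos]] :=
  @sqrt_fixpoint _ _ B (1 - m / M) (1 - (m / M) ^+ 2).
- by rewrite subr_ge0 ler_pdivrMr// mul1r mM/= gerBl divr_ge0// ltW.
- ring.
- by rewrite (ripC x) !BR (ripC x) (ripC (T x)).
- rewrite BR -!rnormE subr_ge0.
  have : rnorm (T x) ^+ 2 <= (M * rnorm x) ^+ 2.
    by rewrite ler_sqr ?nnegrE ?rnorm_ge0 ?TM// mulr_ge0 ?rnorm_ge0 ?ltW.
  have : (m * rnorm x) ^+ 2 <= rnorm (T x) ^+ 2.
    by rewrite ler_sqr ?nnegrE ?rnorm_ge0 ?Tm// mulr_ge0 ?rnorm_ge0.
  move=> /(ler_wpM2l (ltW Mi)) h1 /(ler_wpM2l (ltW Mi)) h2.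
  apply/andP; split.
    apply: le_trans h2 _; rewrite exprMn mulrA mulVf ?mul1r// expf_neq0// gt_eqF//.
  rewrite mulrBl mul1r lerD2l lerN2 (le_trans _ h1)// !exprMn exprVn.
  by lra.
have [P PE] : exists P : {linear H -> H}, P = (fun x => M%:C *: (x - Q x)) :> (H -> H).
  have [|P PE] := linear_bundle (fun x => M%:C *: (x - Q x)).
    by move=> a x y; rewrite linearP opprD addrACA -scalerBr scalerDr !scalerA mulrC.
  by exists P.
have Psym : symmetric_op P by move=> x y; rewrite !PE !ripE Qsym.
have PP x y : rip (P x) (P y) = rip (T x) (T y).
  have : rip (Q x) y = 2^-1 * (rip x y - M ^- 2 * rip (T x) (T y) + rip (Q x) (Q y)).
    by rewrite {1}Qfix !ripE BR (Qsym (Q x)).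
  move=> e; have {}e : rip (Q x) (Q y) =
      2 * rip (Q x) y - rip x y + M ^- 2 * rip (T x) (T y) by lra.
  by rewrite !PE !ripE -(Qsym x y) e; field; rewrite gt_eqF.
exists P; split => // [x y|x].
  by apply: inner_ext => c; rewrite -!linearZ PP.
have c0 : 0 <= (M - m) / 2 by lra.
apply: rnorm_le_sqr; first by rewrite mulr_ge0 ?rnorm_ge0.
have -> : P x - ((M + m) / 2)%:C *: x = ((M - m) / 2)%:C *: x - M%:C *: Q x.
  rewrite PE scalerBr addrAC -scalerBl -rmorphB/=; congr (_%:C *: _ - _); lra.
have gM : M * (1 - m / M) = M - m by field; rewrite gt_eqF.
(* This says [M Q^2 <= (M - m) Q] as forms; times [M], it cancels the last two terms in the
   expansion of the square of [(M - m) / 2 - M Q]. *)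
have : M * rip (Q x) (Q x) <= (M - m) * rip (Q x) x.
  rewrite -gM -mulrA ler_pM2l//; apply: positive_sqr_le => // [|y].
    by rewrite subr_ge0 ler_pdivrMr// mul1r.
  rewrite Qpos (le_trans (rip_le _ _))// -rnormE expr2 mulrA.
  by rewrite ler_wpM2r ?rnorm_ge0.
move=> /(ler_wpM2l (ltW M0)).
rewrite exprMn rnormE !ripE (ripC x (Q x)); lra.
Qed.

End Modulus.

(** * Distance to the scaled isometries *)

Section NormAndMinimumModulus.
Context {R : realType} {H : hilbertType R}.
Implicit Types (x y : H) (S : H -> H).

Lemma bounded_nearP (T : {linear H -> H}) : bounded_near T (nbhs (0 : H)) ->
  exists2 K : R, 0 <= K & forall x, rnorm (T x) <= K * rnorm x.
Proof.
move=> /linear_boundedP[K [Kreal hK]].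
(* The bound is available only for constants strictly above [K], hence the [+ 1]; the maximum
   ensures [0 <= k]. *)
pose k := Num.max 0 (complex.Re K) + 1.
have Kk : K < k%:C.
  by rewrite -(RRe_real Kreal) ltcR ltr_pwDr// le_max lexx orbT.
exists k => [|x]; first by rewrite addr_ge0// le_max lexx.
by rewrite -lecR rmorphM/= -!norm_rnorm hK.
Qed.

Lemma opnorm_le S (c : R) :
  (forall x, rnorm x <= 1 -> rnorm (S x) <= c) -> opnorm S <= c.
Proof.
move=> Sc; apply: ge_sup; last by move=> _ [x /= x1 <-]; exact: Sc.
by exists (rnorm (S 0)), 0 => //=; rewrite rnorm0.
Qed.

(** The bound [K] guarantees that the supremum is a genuine one and not the default value of
    [sup]. *)
Lemma le_opnorm S (K : R) : (forall x, rnorm (S x) <= K * rnorm x) ->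
  forall x, rnorm x <= 1 -> rnorm (S x) <= opnorm S.
Proof.
move=> SK x x1; apply: ub_le_sup; last by exists x.
exists `|K| => _ [y /= y1 <-]; rewrite (le_trans (SK y))//.
by rewrite (le_trans (ler_wpM2r (rnorm_ge0 y) (ler_norm K)))// ler_piMr.
Qed.

Lemma rnorm_le_opnorm (S : {linear H -> H}) (K : R) :
  (forall x, rnorm (S x) <= K * rnorm x) ->
  forall x, rnorm (S x) <= opnorm S * rnorm x.
Proof.
move=> SK x; have [->|x0] := pselect (x = 0); first by rewrite linear0 rnorm0 mulr0.
have := le_opnorm _ _ SK ((rnorm x)^-1%:C *: x).
rewrite linearZ/= rnorm_unit// rnormZr ger0_norm ?invr_ge0 ?rnorm_ge0// => /(_ (lexx 1)).
by rewrite mulrC ler_pdivrMr// rnorm_gt0.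
Qed.

Lemma minmod_le S x : rnorm x = 1 -> minmod S <= rnorm (S x).
Proof.
move=> x1; apply: ge_inf; last by exists x.
by exists 0 => _ [y _ <-]; exact: rnorm_ge0.
Qed.

(** The vector [e] keeps the set of values nonempty, so that [inf] is not its default value. *)
Lemma minmod_ge S (c : R) (e : H) : rnorm e = 1 ->
  (forall x, rnorm x = 1 -> c <= rnorm (S x)) -> c <= minmod S.
Proof.
move=> e1 Sc; apply: lb_le_inf; last by move=> _ [x /= x1 <-]; exact: Sc.
by exists (rnorm (S e)), e.
Qed.

Lemma minmod_le_rnorm (S : {linear H -> H}) x : minmod S * rnorm x <= rnorm (S x).
Proof.
have [->|x0] := pselect (x = 0); first by rewrite linear0 rnorm0 mulr0.
have := minmod_le S _ (rnorm_unit _ x0).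
rewrite linearZ/= rnormZr ger0_norm ?invr_ge0 ?rnorm_ge0// mulrC.
by rewrite ler_pdivlMr// rnorm_gt0.
Qed.

End NormAndMinimumModulus.

(** * The orthogonality constant in terms of the norm and the minimum modulus *)

Section AlmostOrthogonalityPreserving.
Context {R : realType} {H : hilbertType R} (T : {linear H -> H}).
Implicit Types (x y : H) (M m e : R).

(* For [u] orthogonal to [v], [u + v] and [u - v] have the same norm, so
   [m |T (u + v)| <= M |T (u - v)|]; this is used with [|T u| = |T v|] and
   [<T u, T v>] real. *)
Lemma AOP_of_bounds M m : 0 < M -> 0 <= m ->
  (forall x, rnorm (T x) <= M * rnorm x) -> (forall x, m * rnorm x <= rnorm (T x)) ->
  AOP ((M ^+ 2 - m ^+ 2) / (M ^+ 2 + m ^+ 2)) T.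
Proof.
move=> M0 m0 TM Tm x y xy.
have s0 : 0 < M ^+ 2 + m ^+ 2 by rewrite ltr_pwDl ?sqr_ge0 ?exprn_gt0.
have [c c1 hc] := unit_phase '[T x, T y].
set a := rnorm (T x); set b := rnorm (T y).
have := inner_norm_le (T x) (T y); rewrite -/a -/b.
set k := rnorm _ in hc * => kab.
have [ab0|ab0] := leP (a * b) 0.
  have ab_eq0 : a * b = 0 by apply: le_anti; rewrite ab0 mulr_ge0 ?rnorm_ge0.
  by rewrite -mulrA ab_eq0 mulr0 -ab_eq0.
(* The crossed factors [a] and [b] equalize the norms of the images, and the phase [c] makes their
   inner product real. *)
pose u := b%:C *: (c *: x); pose v := a%:C *: y.
have uv : rip u v = 0 by rewrite /u /v !ripE /rip linearZl_LR/= xy mulr0 !mulr0.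
have Tuv : rip (T u) (T v) = a * b * k.
  rewrite /u /v !linearZ/= !ripE /rip linearZl_LR/= hc/=; ring.
have Tu : rip (T u) (T u) = (a * b) ^+ 2.
  by rewrite -rnormE /u !linearZ/= rnormZr rnormZ c1 ger0_norm ?rnorm_ge0// mul1r mulrC.
have Tv : rip (T v) (T v) = (a * b) ^+ 2.
  by rewrite -rnormE /v !linearZ/= rnormZr ger0_norm ?rnorm_ge0.
clearbody u v.
have h1 : rip (T (u + v)) (T (u + v)) <= M ^+ 2 * rip (u + v) (u + v).
  by rewrite -!rnormE -exprMn ler_sqr ?nnegrE ?TM ?mulr_ge0 ?rnorm_ge0// ltW.
have h2 : m ^+ 2 * rip (u - v) (u - v) <= rip (T (u - v)) (T (u - v)).
  by rewrite -!rnormE -exprMn ler_sqr ?nnegrE ?Tm ?mulr_ge0 ?rnorm_ge0.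
(* Eliminating the common value of [|u + v|^2] and [|u - v|^2] leaves
   [m^2 (a b + k) <= M^2 (a b - k)], up to a positive factor. *)
have := ler_wpM2l (sqr_ge0 m) h1; have := ler_wpM2l (sqr_ge0 M) h2.
rewrite (linearB T) (linearD T u v) !ripE (ripC v) (ripC (T v)) uv Tuv Tu Tv => h3 h4.
rewrite -mulrA mulrAC ler_pdivlMr// -(ler_pM2l ab0); lra.
Qed.

(* Conversely, [p + q] and [p - q] are orthogonal for unit vectors [p], [q]
   with [<p, q>] real. *)
Lemma AOP_ratio e p q : 0 <= e -> AOP e T -> rnorm p = 1 -> rnorm q = 1 ->
  (1 - e) * rnorm (T p) ^+ 2 <= (1 + e) * rnorm (T q) ^+ 2.
Proof.
move=> e0 Te p1 q1; have [c c1 hc] := unit_phase '[p, q].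
pose p' := c *: p.
have <- : rnorm (T p') = rnorm (T p) by rewrite linearZ/= rnormZ c1 mul1r.
have p'1 : '[p', p'] = 1 by rewrite -sqr_normE norm_rnorm rnormZ c1 p1 mul1r expr1n.
have p'q : '[p', q] = (rnorm '[p, q])%:C by rewrite linearZl_LR.
have qp' : '[q, p'] = '[p', q] by rewrite innerC p'q conjc_real.
have pq : '[p' + q, p' - q] = 0.
  rewrite linearDl !linearBr/= qp' p'1 -sqr_normE norm_rnorm q1.
  by rewrite expr1n; ring.
clearbody p'.
have := Te _ _ pq; rewrite (linearB T) (linearD T p' q).
have : complex.Re '[T p' + T q, T p' - T q] <= rnorm '[T p' + T q, T p' - T q].
  by rewrite -lecR -norm_rnorm (le_trans _ (normc_ge_Re _))// lecR ler_norm.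
rewrite -/(rip _ _) !ripE (ripC (T q)) -!rnormE => h1 h2.
have := parallelogram (T p') (T q).
move: (rnorm (T p' + T q)) (rnorm (T p' - T q)) h2 => s t h2 h3.
(* [e s t <= e (s^2 + t^2) / 2], and by the parallelogram identity the right side is
   [e (|T p|^2 + |T q|^2)]. *)
have : 0 <= e * (s - t) ^+ 2 by rewrite mulr_ge0 ?sqr_ge0.
have := congr1 ( *%R e) h3; nra.
Qed.

Lemma eps_hatE (K : R) (x0 : H) : (forall x, rnorm (T x) <= K * rnorm x) ->
  rnorm x0 = 1 -> 0 < opnorm T ->
  eps_hat T = (opnorm T ^+ 2 - minmod T ^+ 2) / (opnorm T ^+ 2 + minmod T ^+ 2).
Proof.
move=> TK x01 M0.
have m0 : 0 <= minmod T by apply: (minmod_ge _ _ _ x01) => x _; exact: rnorm_ge0.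
have TM := rnorm_le_opnorm T _ TK; have Tm := minmod_le_rnorm T.
have mM : minmod T <= opnorm T.
  by rewrite (le_trans (minmod_le _ _ x01))// (le_opnorm _ _ TK)// x01.
move: (AOP_of_bounds _ _ M0 m0 TM Tm).
set M := opnorm T in M0 TM mM *; set m := minmod T in m0 Tm mM * => TAOP.
have s0 : 0 < M ^+ 2 + m ^+ 2 by rewrite ltr_pwDl ?sqr_ge0 ?exprn_gt0.
have mM2 : m ^+ 2 <= M ^+ 2 by rewrite ler_sqr ?nnegrE// ltW.
have m20 := sqr_ge0 m.
have eps01 : 0 <= (M ^+ 2 - m ^+ 2) / (M ^+ 2 + m ^+ 2) <= 1.
  by rewrite divr_ge0 ?subr_ge0 ?(ltW s0)//= ler_pdivrMr//; lra.
apply: le_anti; apply/andP; split.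
  by apply: ge_inf => //; exists 0 => e [/andP[]].
apply: lb_le_inf; first by exists ((M ^+ 2 - m ^+ 2) / (M ^+ 2 + m ^+ 2)).
move=> e [/andP[e0 e1] Te].
have [e1'|e1'] := leP 1 e; first by case/andP: eps01 => _ /le_trans; apply.
pose k := (1 + e) / (1 - e); have k0 : 0 < k by rewrite divr_gt0; lra.
(* The root makes [AOP_ratio] linear in the norms, so the supremum over [p] and the infimum over [q]
   give [M <= s * m]; squaring this bounds the ratio by [e]. *)
pose s := Num.sqrt k; have s1 : 0 < s by rewrite sqrtr_gt0.
have ratio p q : rnorm p = 1 -> rnorm q = 1 -> rnorm (T p) <= s * rnorm (T q).
  move=> p1 q1; have := AOP_ratio _ _ _ e0 Te p1 q1 => h.
  rewrite -ler_sqr ?nnegrE ?mulr_ge0 ?rnorm_ge0 ?(ltW s1)//.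
  rewrite exprMn sqr_sqrtr ?(ltW k0)// /k mulrAC ler_pdivlMr; lra.
have Mm : M <= s * m.
  rewrite mulrC -ler_pdivrMr//; apply: (minmod_ge _ _ _ x01) => q q1.
  rewrite ler_pdivrMr// mulrC; apply: opnorm_le => x x1.
  have [->|x_neq0] := pselect (x = 0).
    by rewrite linear0 rnorm0 mulr_ge0 ?rnorm_ge0 ?(ltW s1).
  apply: le_trans (ratio _ _ (rnorm_unit _ x_neq0) q1).
  rewrite linearZ/= rnormZr ger0_norm ?invr_ge0 ?rnorm_ge0//.
  by rewrite ler_peMl ?rnorm_ge0// invf_ge1// rnorm_gt0.
have : M ^+ 2 <= (s * m) ^+ 2.
  by rewrite ler_sqr ?nnegrE ?mulr_ge0 ?(ltW s1) ?(ltW M0).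
rewrite exprMn sqr_sqrtr ?(ltW k0)// /k mulrAC ler_pdivlMr; last by lra.
rewrite ler_pdivrMr//; lra.
Qed.

End AlmostOrthogonalityPreserving.

(** * Polar decomposition and the value of the distance *)

Section Distance.
Context {R : realType} {H : hilbertType R} (T : {linear H -> H}) (K : R).
Hypothesis TK : forall x, rnorm (T x) <= K * rnorm x.
Implicit Types (x y : H) (M m : R).

(* Polar decomposition: [P z |-> T z] is completed on [ker T] by an isometry
   into [ker T^*]. *)
Lemma polar_isometry (P : {linear H -> H}) :
  hdim_le (ker T) (ker (adjoint T)) -> symmetric_op P ->
  (forall x y, '[P x, P y] = '[T x, T y]) ->
  exists2 V : H -> H, isometries V & forall x, V (P x) = T x.
Proof.
move=> [B [C [[Bker [B1 B2] Bdense] [Cker [C1 C2] _]]]] /pcard_leP[f] Psym PT.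
have adj := inner_adjoint T K TK.
have Pnorm x : rnorm (P x) = rnorm (T x).
  by apply/eqP; rewrite -(eqrXn2 (n := 2)) ?rnorm_ge0// !rnormE /rip PT.
have PB z b : B b -> '[P z, b] = 0.
  move=> /Bker Tb; apply: inner_eq0 => c; rewrite -linearZ/= Psym.
  by rewrite (_ : P b = 0) ?ripE//; apply: rnorm_eq0; rewrite Pnorm Tb rnorm0.
have TC z c : C c -> '[T z, c] = 0.
  by move=> /Cker; rewrite /ker/= adj => ->; rewrite linear0r.
have fC b : B b -> C (f b) by exact: funS.
(* The range of [P] together with a basis of [ker T] is total. By [PB] and [TC] the two kinds of
   vectors are orthogonal in both families, so the Gram matrices agree. *)
pose u (i : H + {b | B b}) := match i with inl z => P z | inr b => sval b end.
pose v (i : H + {b | B b}) := match i with inl z => T z | inr b => f (sval b) end.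
have [|z hz|V V1 Vu] := @isometry_extension _ _ _ u v.
- move=> [z|[b Bb]] [z'|[b' Bb']] /=; first exact: PT.
  + by rewrite PB// TC//; exact: fC.
  + by rewrite innerC PB// innerC TC//; exact: fC.
  + have [->|bb'] := pselect (b = b'); first by rewrite B1// C1//; exact: fC.
    rewrite B2// C2//; [exact: fC|exact: fC|].
    by move=> /(inj (f := f)) => h; apply: bb'; apply: h; rewrite inE.
- have Pz : P z = 0.
    by apply: rip_inner_inj => w; rewrite -Psym ripE /rip (hz (inl w)).
  have Bz b : B b -> '[b, z] = 0 by move=> Bb; exact: (hz (inr (exist _ b Bb))).
  have /Bdense zB : ker T z by apply: rnorm_eq0; rewrite -Pnorm Pz rnorm0.
  apply/rnorm_eq0/le_anti; rewrite rnorm_ge0 andbT.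
  apply/ler_addgt0Pr => e e0; rewrite add0r.
  have e0' : 0 < e%:C by rewrite ltcR.
  have [w [[s [a [sB ->]]]]] := zB _ (nbhsx_ballx z _ e0').
  rewrite -ball_normE/= norm_rnorm ltcR; set w' := \sum_(_ <- _) _ => zw.
  have w0 : rip w' z = 0.
    rewrite /rip; have -> : '[w', z] = 0; last by [].
    rewrite /w' (big_morph (fun x => '[x, z]) (id1 := 0) (op1 := +%R)).
    - by rewrite big_seq big1// => b /sB/Bz bz; rewrite linearZl_LR/= bz mulr0.
    - by move=> x y; rewrite linearDl.
    - by rewrite linear0l.
  have [->|/rnorm_gt0 z0] := pselect (z = 0); first by rewrite rnorm0 ltW.
  (* [w'] is orthogonal to [z], so [|z|^2 = <z - w', z>], whence [|z| <= |z - w'| < e]. *)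
  have := rip_le (z - w') z; rewrite !ripE w0 subr0 -rnormE expr2 ler_pM2r// => h.
  by rewrite (le_trans h)// ltW.
- by exists V => // x; exact: (Vu (inl x)).
Qed.

Lemma opdist_scaled_isometries (x0 : H) : rnorm x0 = 1 ->
  hdim_le (ker T) (ker (adjoint T)) ->
  opdist T scaled_isometries = (opnorm T - minmod T) / 2.
Proof.
move=> x01 dim_ker.
have m0 : 0 <= minmod T by apply: (minmod_ge _ _ _ x01) => x _; exact: rnorm_ge0.
have TM := rnorm_le_opnorm T _ TK; have Tm := minmod_le_rnorm T.
have mM : minmod T <= opnorm T.
  by rewrite (le_trans (minmod_le _ _ x01))// (le_opnorm _ _ TK)// x01.
have lower S : scaled_isometries S -> (opnorm T - minmod T) / 2 <= opnorm (T \- S).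
  move=> [l [V [[Vlin V1] ->]]].
  have lV x : rnorm (l *: V x) = rnorm l * rnorm x by rewrite rnormZ V1.
  have TS : forall x, rnorm ((T \- (fun x => l *: V x)) x) <= (K + rnorm l) * rnorm x.
    move=> x /=; rewrite mulrDl (le_trans (ler_rnormD _ _))// lerD//.
    by rewrite rnormN lV.
  have h1 : opnorm T <= opnorm (T \- (fun x => l *: V x)) + rnorm l.
    apply: opnorm_le => x x1; have := le_opnorm _ _ TS x x1.
    have := ler_rnorm_subr (T x) (l *: V x); rewrite lV /=.
    have := ler_wpM2l (rnorm_ge0 l) x1; lra.
  have h2 : rnorm l - opnorm (T \- (fun x => l *: V x)) <= minmod T.
    apply: (minmod_ge _ _ _ x01) => x x1.
    have := le_opnorm _ _ TS x; rewrite x1 => /(_ (lexx 1))/=.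
    have := ler_rnorm_subr (l *: V x) (T x); rewrite lV x1 rnormBC; lra.
  lra.
have [|P [Psym PT Pnorm]] := modulus T _ _ _ TM Tm; first by rewrite m0.
have [V V1 VP] := polar_isometry P dim_ker Psym PT.
pose l := (opnorm T + minmod T) / 2.
have upper : opnorm (T \- (fun x => l%:C *: V x)) <= (opnorm T - minmod T) / 2.
  apply: opnorm_le => x x1 /=.
  have -> : T x - l%:C *: V x = V (P x - l%:C *: x).
    by rewrite -VP addrC -scaleNr -V1.1 scaleNr addrC.
  rewrite V1.2 (le_trans (Pnorm x))// ler_piMr//; lra.
apply: le_anti; apply/andP; split.
  apply: le_trans upper; apply: ge_inf; last first.
    by exists (fun x => l%:C *: V x) => //; exists l%:C, V.
  exists ((opnorm T - minmod T) / 2) => _ [S hS <-]; exact: lower.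
apply: lb_le_inf; last by move=> _ [S hS <-]; exact: lower.
exists (opnorm (T \- (fun x => l%:C *: V x))), (fun x => l%:C *: V x) => //.
by exists l%:C, V.
Qed.

End Distance.

(** Excludes the zero space, where the infimum defining [minmod] runs over the empty set. *)
Lemma unit_vector (R : realType) (H : hilbertType R) n :
  (0 < n)%N -> hdim_ge n [set: H] -> exists x : H, rnorm x = 1.
Proof.
move=> n0 [B [_ [B1 _] _] /pcard_leP[f]].
have Bf : B (f 0%N) by apply: funS.
exists (f 0%N); apply/eqP; rewrite -(eqrXn2 (n := 2)) ?rnorm_ge0 ?ler01//.
by rewrite rnormE /rip B1// expr1n.
Qed.

Theorem theorem3p5 (R : realType) (H : hilbertType R)
    (dimH : hdim_ge 2 [set: H])
    (T : {linear H -> H}) (bT : bounded_near T (nbhs (0 : H)))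
    (dim_ker : hdim_le (ker T) (ker (adjoint T))) :
  opdist T scaled_isometries = (opnorm T - minmod T) / 2 /\
  (opnorm T - minmod T) / 2 =
    (1 - Num.sqrt ((1 - eps_hat T) / (1 + eps_hat T))) / 2 * opnorm T.
Proof.
have [x0 x01] := unit_vector R H 2 isT dimH.
have [K _ TK] := bounded_nearP T bT.
split; first exact: (opdist_scaled_isometries _ _ TK x0).
have m0 : 0 <= minmod T by apply: (minmod_ge _ _ _ x01) => x _; exact: rnorm_ge0.
have mM : minmod T <= opnorm T.
  by rewrite (le_trans (minmod_le _ _ x01))// (le_opnorm _ _ TK)// x01.
(* For [T = 0] the quotient expressing [eps_hat T] degenerates to 0/0, but the factor [opnorm T]
   makes both sides vanish. *)
have [M0|M0] := leP (opnorm T) 0.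
  have M_eq0 : opnorm T = 0 by lra.
  have -> : minmod T = 0 by lra.
  by rewrite M_eq0 mulr0 subrr mul0r.
rewrite (eps_hatE T _ _ TK x01 M0).
move: (opnorm T) (minmod T) M0 mM m0 => M m M0 mM m0.
have s0 : M ^+ 2 + m ^+ 2 != 0.
  by rewrite gt_eqF// ltr_pwDl ?sqr_ge0 ?exprn_gt0.
(* Over the common denominator [M^2 + m^2], the numerators of [1 - eps_hat T] and [1 + eps_hat T]
   are [2 m^2] and [2 M^2]. *)
set q := (X in Num.sqrt X).
have -> : q = (m / M) ^+ 2.
  rewrite /q; field; rewrite s0 gt_eqF//=.
  rewrite (_ : _ + _ = 2 * M ^+ 2); last by ring.
  by rewrite mulf_neq0 ?expf_neq0 ?gt_eqF.
rewrite sqrtr_sqr ger0_norm ?divr_ge0 ?(ltW M0)//.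
by field; rewrite gt_eqF.
Qed.
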